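(* Assume that Variant A.2 of the algorithm described in the context does not stop, and let $\{x^k\}_{k\in\mathbb{N}}$ be the sequence it generates. Then $\{x^k\}_{k\in\mathbb{N}}$ converges to some point belonging to $S^*\cap X$.
   Context: Setting. $\mathbb{R}^n$ carries its inner product $\langle\cdot,\cdot\rangle$ and norm $\|\cdot\|$; $P_C$ is the orthogonal projection onto a nonempty closed convex set $C$; $B[c,r]$ is the closed ball with center $c$ and radius $r$. Let $\mathbb{I}=\{1,\dots,m\}$, $m\in\mathbb{N}$. For $i\in\mathbb{I}$, $A_i:\mathbb{R}^n\to\mathbb{R}^n$ is point-to-point and maximal monotone, $B_i:\mathbb{R}^n\to2^{\mathbb{R}^n}$ is point-to-set and maximal monotone, $\mathrm{dom}(B_i)\subseteq\mathrm{dom}(A_i)$. Let $S_i^*=\{x: 0\in A_i(x)+B_i(x)\}$, $S^*=\bigcap_{i\in\mathbb{I}}S_i^*$. $X\subseteq\bigcap_{i\in\mathbb{I}}\mathrm{dom}(B_i)$ is a nonempty closed convex set with $X\cap S^*\neq\emptyset$. Assumption on $B_i$: for each bounded subset $V$ of $\mathrm{dom}(B_i)$ there exists $R>0$ such that $B_i(x)\cap B[0,R]\ne\emptyset$ for all $x\in V$, $i\in\mathbb{I}$. Parameters: $\{\beta_k\}_{k\in\mathbb{N}}\subseteq[\check\beta,\hat\beta]$ with $0<\check\beta\le\hat\beta<\infty$; $\theta,\delta\in(0,1)$; $R>0$ is a constant provided by this assumption for a bounded set containing the points at which elements of $B_i$ are selected in Step 3, so that those selections are possible. Algorithm (Variant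 A.2). Step 0: take $x^0\in X$. Step 1: given $x^k$, compute $J_i(x^k,\beta_k):=(I+\beta_kB_i)^{-1}(I-\beta_kA_i)(x^k)$ for all $i\in\mathbb{I}$. Step 2: let $\mathbb{I}_k^*:=\{i\in\mathbb{I}: x^k=J_i(x^k,\beta_k)\}$; if $\mathbb{I}_k^*=\mathbb{I}$, stop. Step 3 (inner loop): otherwise, for each $i\in\mathbb{I}\setminus\mathbb{I}_k^*$ and successively $j=0,1,2,\dots$, choose any $u^k_{(j,i)}\in B_i\big(\theta^jJ_i(x^k,\beta_k)+(1-\theta^j)x^k\big)\cap B[0,R]$; at the first $j$ for which $\big\langle A_i(\theta^jJ_i(x^k,\beta_k)+(1-\theta^j)x^k)+u^k_{(j,i)},x^k-J_i(x^k,\beta_k)\big\rangle\ge\frac{\delta}{\beta_k}\|x^k-J_i(x^k,\beta_k)\|^2$, set $j_i(k):=j$ and stop the inner loop. Step 4: for $i\in\mathbb{I}\setminus\mathbb{I}_k^*$ set $\alpha_{k,i}:=\theta^{j_i(k)}$, $\bar u_i^k:=u^k_{(j_i(k),i)}$, $\bar x_i^k:=\alpha_{k,i}J_i(x^k,\beta_k)+(1-\alpha_{k,i})x^k$, and set $x^{k+1}:=P_{X\cap H_k}(x^k)$, where $H_i(x,u)=\{y\in\mathbb{R}^n:\langle A_i(x)+u,y-x\rangle\le0\}$ and $H_k=\bigcap_{i\in\mathbb{I}\setminus\mathbb{I}_k^*}H_i(\bar x_i^k,\bar u_i^k)$. Step 5: if $x^{k+1}=x^k$, stop; otherwise replace $k$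 by $k+1$ and go to Step 1. *)

(* Defs.v *)
From HB Require Import structures.
From mathcomp Require Import all_boot all_order all_algebra.
From mathcomp Require Export all_classical all_reals all_analysis.

Set Implicit Arguments.
Unset Strict Implicit.
Unset Printing Implicit Defensive.

Import Order.TTheory GRing.Theory Num.Theory.
Import numFieldNormedType.Exports.

Local Open Scope classical_set_scope.
Local Open Scope ring_scope.

(* The library norm `|x| of 'rV[R]_n is the sup norm; it is used here only
   through the topology and bornology it induces (closed, bounded_set, -->),
   which are the Euclidean ones.  All metric notions use [enorm]. *)
Definition dot (R : realType) (n : nat) (x y : 'rV[R]_n) : R :=
  (x *m y^T) 0 0.

Definition enorm (R : realType) (n : nat) (x : 'rV[R]_n) : R :=
  Num.sqrt (dot x x).

Definition cball (R : realType) (n : nat) (c : 'rV[R]_n) (r : R) :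
  set 'rV[R]_n := [set y | enorm (y - c) <= r].

Definition is_proj (R : realType) (n : nat) (C : set 'rV[R]_n)
    (x p : 'rV[R]_n) : Prop :=
  C p /\ forall y, C y -> enorm (x - p) <= enorm (x - y).

(* Point-to-set operators R^n -> 2^(R^n). *)
Definition operator (R : realType) (n : nat) : Type :=
  'rV[R]_n -> set 'rV[R]_n.

Definition dom (R : realType) (n : nat) (T : operator R n) : set 'rV[R]_n :=
  [set x | T x !=set0].

(* The point-to-point operator x |-> f x with domain D; the values of f
   outside D are irrelevant.  D = setT gives an everywhere defined map. *)
Definition point_op (R : realType) (n : nat) (D : set 'rV[R]_n)
    (f : 'rV[R]_n -> 'rV[R]_n) : operator R n :=
  fun x => [set u | D x /\ u = f x].

Definition op_id (R : realType) (n : nat) : operator R n := fun x => [set x].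

Definition op_add (R : realType) (n : nat) (S T : operator R n) :
  operator R n := fun x => [set u + v | u in S x & v in T x].

Definition op_scale (R : realType) (n : nat) (b : R) (T : operator R n) :
  operator R n := fun x => [set b *: u | u in T x].

Definition op_inv (R : realType) (n : nat) (T : operator R n) :
  operator R n := fun u => [set x | T x u].

Definition op_comp (R : realType) (n : nat) (S T : operator R n) :
  operator R n := fun x => \bigcup_(y in T x) S y.

Definition monotone (R : realType) (n : nat) (T : operator R n) : Prop :=
  forall x y u v, T x u -> T y v -> 0 <= dot (u - v) (x - y).

Definition maximal_monotone (R : realType) (n : nat) (T : operator R n) :
  Prop :=
  monotone T /\
  forall T' : operator R n,
    monotone T' -> (forall x, T x `<=` T' x) -> T' = T.

Definition sol_set (R : realType) (n : nat) (A B : operator R n) :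
  set 'rV[R]_n := [set x | op_add A B x 0].

(* J(., b) = (I + b B)^-1 (I - b A) as a point-to-set operator; it is single
   valued when B is maximal monotone and b > 0. *)
Definition forward_backward (R : realType) (n : nat) (A B : operator R n)
    (b : R) : operator R n :=
  op_comp (op_inv (op_add (@op_id R n) (op_scale b B)))
          (op_add (@op_id R n) (op_scale (- b) A)).

Definition sel_bound (R : realType) (n m : nat) (B : 'I_m -> operator R n)
    (V : 'I_m -> set 'rV[R]_n) (r : R) : Prop :=
  forall i x, V i x -> B i x `&` cball 0 r !=set0.

Definition bounded_in_dom (R : realType) (n m : nat)
    (B : 'I_m -> operator R n) (V : 'I_m -> set 'rV[R]_n) : Prop :=
  forall i, bounded_set (V i) /\ V i `<=` dom (B i).

Definition trial (R : realType) (n : nat) (theta : R) (x J : 'rV[R]_n)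
    (j : nat) : 'rV[R]_n :=
  theta ^+ j *: J + (1 - theta ^+ j) *: x.

Definition linesearch_test (R : realType) (n : nat)
    (f : 'rV[R]_n -> 'rV[R]_n) (delta b : R) (x J p u : 'rV[R]_n) : Prop :=
  delta / b * enorm (x - J) ^+ 2 <= dot (f p + u) (x - J).

Definition halfspace (R : realType) (n : nat) (f : 'rV[R]_n -> 'rV[R]_n)
    (p u : 'rV[R]_n) : set 'rV[R]_n :=
  [set y | dot (f p + u) (y - p) <= 0].

(* The index set I_k^* of the components solved at the point x = x^k, where
   J i = J_i(x^k, beta_k). *)
Definition solved (R : realType) (n m : nat) (x : 'rV[R]_n)
    (J : 'I_m -> 'rV[R]_n) : set 'I_m :=
  [set i | x = J i].

(* [x k], [J k i], [u k i j] and [js k i] stand for x^k, J_i(x^k, beta_k),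
   u^k_(j,i) and j_i(k).  The values [u k i j] with j > j_i(k), and the values
   of u and js for i in I_k^*, are not produced by the algorithm and are left
   unconstrained. *)
Record variantA2_run (R : realType) (n m : nat)
    (DA : 'I_m -> set 'rV[R]_n) (A : 'I_m -> 'rV[R]_n -> 'rV[R]_n)
    (B : 'I_m -> operator R n) (X : set 'rV[R]_n)
    (beta : nat -> R) (theta delta Rad : R)
    (x : nat -> 'rV[R]_n) (J : nat -> 'I_m -> 'rV[R]_n)
    (u : nat -> 'I_m -> nat -> 'rV[R]_n) (js : nat -> 'I_m -> nat) : Prop :=
  VariantA2Run {
    run_init : X (x 0%N);
    run_resolvent : forall k i,
      forward_backward (point_op (DA i) (A i)) (B i) (beta k) (x k) (J k i);
    run_select : forall k i j, ~ solved (x k) (J k) i -> (j <= js k i)%N ->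
      (B i (trial theta (x k) (J k i) j) `&` cball 0 Rad) (u k i j);
    run_reject : forall k i j, ~ solved (x k) (J k) i -> (j < js k i)%N ->
      ~ linesearch_test (A i) delta (beta k) (x k) (J k i)
          (trial theta (x k) (J k i) j) (u k i j);
    run_accept : forall k i, ~ solved (x k) (J k) i ->
      linesearch_test (A i) delta (beta k) (x k) (J k i)
        (trial theta (x k) (J k i) (js k i)) (u k i (js k i));
    run_project : forall k,
      is_proj
        (X `&` \bigcap_(i in ~` solved (x k) (J k))
           halfspace (A i) (trial theta (x k) (J k i) (js k i))
             (u k i (js k i)))
        (x k) (x k.+1)
  }.

Definition never_stops (R : realType) (n m : nat) (x : nat -> 'rV[R]_n)
    (J : nat -> 'I_m -> 'rV[R]_n) : Prop :=
  forall k, solved (x k) (J k) <> setT /\ x k.+1 <> x k.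

(* Main.v *)
Require Import Defs.
From mathcomp Require Import all_boot all_order all_algebra.
From mathcomp Require Import all_classical all_reals all_analysis.
From mathcomp Require Import ring lra.
Set Implicit Arguments.
Unset Strict Implicit.
Unset Printing Implicit Defensive.
Import Order.TTheory GRing.Theory Num.Theory.
Import numFieldNormedType.Exports.
Local Open Scope classical_set_scope.
Local Open Scope ring_scope.

(** Each cut [halfspace f p u] built from [u] in [B_i p] contains every zero of
[A_i + B_i], by monotonicity.  Hence projecting onto [X] intersected with the
cuts brings [x k] closer to every common solution in [X], and the squared
distances to such a point drop by at least the squared step length
([fejer_step]): the iterates are bounded and their steps tend to [0].  As
these distances decrease, it is then enough that one cluster point [l] of the
iterates be a common solution ([fejer_cvg]).

For the component [i] put [J = J_i(x k, beta k)] and call [x k - J] the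
residual.  By definition of the resolvent, [B_i J] contains
[(x k - J) / beta k - A_i (x k)]; so if the residual tends to [0] along
the iterates approaching [l], closedness of the graph of [B_i] and continuity of
[A_i] give [- A_i l] in [B_i l] ([zero_of_vanishing_residual]).  The residual
does vanish ([residual_vanishes]):
- since [x k.+1] lies in the cut and the trial point was accepted,
  [theta ^ j * |x k - J|^2] is at most a constant times the step length, which
  settles the indices where [theta ^ j] is not small
  ([accepted_residual_le]);
- where [theta ^ j] is small, the trial point [p] rejected just before is close
  to [x k].  Monotonicity of [B_i] between [p] and [J], confronted with the
  failed test, bounds the residual by a constant times [|A_i (x k) - A_i p|]
  ([rejected_residual_le]), which is small because [A_i] is continuous at [l].

Two facts about maximal monotone operators on a finite-dimensional space make
the constants finite.  A single-valued maximal monotone operator is continuous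
at each point of its domain, relatively to that domain
([maximal_monotone_point_cvg]).  And the bounded selection property forces
[dom B_i] to be closed ([dom_closed]); as [dom B_i] lies in the domain of
[A_i], this makes [A_i] bounded on every bounded part of [dom B_i]
([point_op_bounded_on]).

Compactness is used through ultrafilters: a bounded sequence converges along any
ultrafilter, which replaces the repeated extraction of subsequences.  Estimates
use the sup norm, related to [dot] by [norm_sq_le_dot] and [dot_le_norm], except
for the decrease of the distances to solutions, which is Euclidean. *)

(** * The inner product *)

Lemma dotE (R : realType) n (x y : 'rV[R]_n) :
  dot x y = \sum_i x 0 i * y 0 i.
Proof. by rewrite /dot mxE; apply: eq_bigr => i _; rewrite mxE. Qed.

Lemma dotC (R : realType) n (x y : 'rV[R]_n) : dot x y = dot y x.
Proof. by rewrite !dotE; apply: eq_bigr => i _; rewrite mulrC. Qed.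

Lemma dotDl (R : realType) n (x y z : 'rV[R]_n) :
  dot (x + y) z = dot x z + dot y z.
Proof. by rewrite /dot mulmxDl mxE. Qed.

Lemma dotZl (R : realType) n (a : R) (x y : 'rV[R]_n) :
  dot (a *: x) y = a * dot x y.
Proof. by rewrite /dot -scalemxAl mxE. Qed.

Lemma dotNl (R : realType) n (x y : 'rV[R]_n) : dot (- x) y = - dot x y.
Proof. by rewrite -scaleN1r dotZl mulN1r. Qed.

Lemma dotDr (R : realType) n (x y z : 'rV[R]_n) :
  dot z (x + y) = dot z x + dot z y.
Proof. by rewrite dotC dotDl !(dotC _ z). Qed.

Lemma dotZr (R : realType) n (a : R) (x y : 'rV[R]_n) :
  dot x (a *: y) = a * dot x y.
Proof. by rewrite dotC dotZl dotC. Qed.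

Lemma dotNr (R : realType) n (x y : 'rV[R]_n) : dot x (- y) = - dot x y.
Proof. by rewrite dotC dotNl dotC. Qed.

Definition dot_lin := (dotDl, dotDr, dotNl, dotNr, dotZl, dotZr).

Lemma dot_ge0 (R : realType) n (x : 'rV[R]_n) : 0 <= dot x x.
Proof. by rewrite dotE; apply: sumr_ge0 => i _; exact: sqr_ge0. Qed.

Lemma enorm_sq (R : realType) n (x : 'rV[R]_n) : enorm x ^+ 2 = dot x x.
Proof. by rewrite sqr_sqrtr // dot_ge0. Qed.

Lemma coord_le_norm (R : realType) n (x : 'rV[R]_n) i : `|x 0 i| <= `|x|.
Proof.
rewrite [leRHS]mx_normrE.
exact: (le_bigmax _ (fun ij => `|x ij.1 ij.2|) (0, i)).
Qed.

Lemma dot_le_norm (R : realType) n (x y : 'rV[R]_n) :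
  `|dot x y| <= n%:R * (`|x| * `|y|).
Proof.
rewrite dotE (le_trans (ler_norm_sum _ _ _))// -[n in n%:R]card_ord -sum1_card.
rewrite natr_sum mulr_suml ler_sum// => i _; rewrite mul1r normrM.
by rewrite ler_pM// coord_le_norm.
Qed.

Lemma norm_sq_le_dot (R : realType) n (x : 'rV[R]_n) : `|x| ^+ 2 <= dot x x.
Proof.
have [x0|/mx_norm_neq0[[i j]/= xij]] := eqVneq (mx_norm x) 0.
  by rewrite [`|x|]x0 expr0n/= dot_ge0.
rewrite [`|x|]xij real_normK ?num_real// (ord1 i) dotE (bigD1 j)//= -expr2.
by rewrite lerDl sumr_ge0// => k _; exact: sqr_ge0.
Qed.

Lemma norm_le_enorm (R : realType) n (x : 'rV[R]_n) : `|x| <= enorm x.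
Proof.
rewrite -(@ler_pXn2r _ 2)// ?nnegrE ?sqrtr_ge0//.
by rewrite enorm_sq norm_sq_le_dot.
Qed.

(** * Limits along filters *)

Lemma cvg_dot (R : realType) n (T : Type) (F : set_system T) {FF : Filter F}
    (f g : T -> 'rV[R]_n) (a b : 'rV[R]_n) :
  f @ F --> a -> g @ F --> b -> (fun t => dot (f t) (g t)) @ F --> dot a b.
Proof.
move=> fa gb.
rewrite (_ : (fun t => _) = fun t => \sum_i f t 0 i * g t 0 i); last first.
  by apply/funext => t; rewrite dotE.
have fgi i : (fun t => f t 0 i * g t 0 i) @ F --> a 0 i * b 0 i.
  have coord (h : T -> 'rV[R]_n) (c : 'rV[R]_n) : h @ F --> c ->
      (fun t => h t 0 i) @ F --> c 0 i.
    move=> hc; apply: (@cvg_comp _ _ _ h (fun v : 'rV[R]_n => v 0 i) F _ _ hc).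
    exact: coord_continuous.
  by apply: cvgM; exact: coord.
rewrite dotE; elim: (index_enum _) => [|i r IHr].
  rewrite big_nil (_ : (fun t => _) = cst 0); first exact: cvg_cst.
  by apply/funext => t; rewrite big_nil.
rewrite big_cons (_ : (fun t => _) =
    fun t => f t 0 i * g t 0 i + \sum_(j <- r) f t 0 j * g t 0 j).
  exact: cvgD.
by apply/funext => t; rewrite big_cons.
Qed.

Lemma cvg_sub_cst (R : realType) n (T : Type) (F : set_system T)
    {FF : Filter F} (f : T -> 'rV[R]_n) (a c : 'rV[R]_n) :
  f @ F --> a -> (fun t => f t - c) @ F --> a - c.
Proof. by move=> fa; apply: cvgB => //; exact: cvg_cst. Qed.

Lemma bounded_setP (R : realType) n (V : set 'rV[R]_n) :
  bounded_set V <-> exists M : R, forall x, V x -> `|x| <= M.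
Proof.
split=> [/pinfty_ex_gt0[M _ MV]|[M MV]]; first by exists M.
exists M; split; first exact: num_real.
by move=> N MN x /MV /le_trans; apply; exact: ltW.
Qed.

(** A property failing to hold eventually fails along a whole ultrafilter: this
turns a convergence statement into the study of ultrafilters that stay away from
the limit. *)
Lemma ultra_not_near {T : Type} {F : set_system T} {FF : Filter F} {P : set T} :
  ~ F P -> exists G : set_system T, [/\ UltraFilter G, F `<=` G & G (~` P)].
Proof.
move=> FP; have FE : ProperFilter (within (~` P) F).
  split; last exact: within_filter.
  rewrite /within/= => F0; apply: FP; apply: filterS F0 => t /= h.
  by apply: contrapT => /h.
have [G [GU FG]] := ultraFilterLemma FE; exists G; split => //.
  move=> A FA; apply: FG; rewrite /within/=; near=> t => _.
  by near: t; exact: FA.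
by apply: FG; exact: withinT.
Unshelve. all: by end_near. Qed.

(** The image of an ultrafilter is an ultrafilter, and it lives on a closed
ball, which is compact. *)
Lemma ultra_bounded_cvg (R : realType) n {T : Type} {G : set_system T}
    (GU : UltraFilter G) (g : T -> 'rV[R]_n) (M : R) :
  G [set t | `|g t| <= M] -> exists l : 'rV[R]_n, g @ G --> l.
Proof.
move=> gM.
have gU : UltraFilter (g @ G).
  split=> [|H HF GH]; first exact: fmap_proper_filter.
  apply/seteqP; split=> // A HA.
  have [//|GA] := in_ultra_setVsetC (g @^-1` A) GU.
  have : H (A `&` ~` A) by apply: filterI => //; exact: GH.
  by rewrite setICr => /filter_not_empty.
have : compact [set y : 'rV[R]_n | `|y| <= M].
  apply: bounded_closed_compact; first by apply/bounded_setP; exists M.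
  have := @closed_comp _ R (fun y : 'rV[R]_n => `|y|) [set r | r <= M].
  by apply; [move=> y _; exact: norm_continuous|exact: closed_le].
rewrite compact_ultra => /(_ _ gU gM)[l [_ ll]].
by exists l.
Qed.

(** * Maximal monotone operators *)

(** Adding the single pair [(x, v)] to the graph of [T] keeps it monotone, so by
maximality the pair was already there. *)
Lemma maximal_monotone_mem (R : realType) n (T : operator R n)
    (x v : 'rV[R]_n) : maximal_monotone T ->
  (forall y w, T y w -> 0 <= dot (v - w) (x - y)) -> T x v.
Proof.
move=> [Tm Tmax] xv.
pose T' : operator R n := fun y => [set w | T y w \/ y = x /\ w = v].
have <- : T' = T by apply: Tmax; [|by move=> y w; left];
  move=> y z w w' [Tyw|[-> ->]] [Tzw|[-> ->]];
    [exact: Tm| |exact: xv|by rewrite !subrr dotE big1// => i _;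
      rewrite !mxE mul0r];
  rewrite -[w - v]opprB -[y - x]opprB dotNl dotNr opprK; exact: xv.
by right.
Qed.

(** The inequalities characterising membership in the graph pass to the
limit. *)
Lemma maximal_monotone_closed_graph (R : realType) n (T : operator R n)
    (I : Type) (F : set_system I) {FF : ProperFilter F}
    (y w : I -> 'rV[R]_n) (x v : 'rV[R]_n) : maximal_monotone T ->
  y @ F --> x -> w @ F --> v -> (\forall t \near F, T (y t) (w t)) -> T x v.
Proof.
move=> Tmm yx wv Tyw; apply: maximal_monotone_mem => // z u Tzu.
apply: (@cvgr_to_ge _ F _ R (fun t => dot (w t - u) (y t - z))).
  exact: cvg_dot (cvg_sub_cst wv) (cvg_sub_cst yx).
by apply: filterS Tyw => t Tt; exact: (Tmm.1 _ _ _ _ Tt Tzu).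
Qed.

(** Local boundedness and continuity come at once.  If [f (y t)] stays at
distance at least [e] from [f x], rescale the difference [d t] to [w t], of norm
exactly [e], and let [w0] be a limit of [w].  Shrinking [d t] amounts to taking
a convex combination of two monotonicity inequalities, one at [y t] and one at
[x], so in the limit [(x, f x + w0)] is monotonically related to the graph.
Maximality puts it in the graph, and single-valuedness gives [w0 = 0],
whereas [|w0| >= e]. *)
Lemma maximal_monotone_point_cvg (R : realType) n (D : set 'rV[R]_n)
    (f : 'rV[R]_n -> 'rV[R]_n) (I : Type) (F : set_system I)
    {FF : Filter F} (y : I -> 'rV[R]_n) (x : 'rV[R]_n) :
  maximal_monotone (point_op D f) -> D x -> y @ F --> x ->
  (\forall t \near F, D (y t)) -> (fun t => f (y t)) @ F --> f x.
Proof.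
move=> fmm Dx yx Dy; apply/cvgrPdist_lt => e e0; apply: contrapT.
move=> /ultra_not_near [G [GU FG Gfar]].
have GP : ProperFilter G by exact: ultra_proper.
pose d t := f (y t) - f x; pose s t := e / `|d t|; pose w t := s t *: d t.
have ed : \forall t \near G, e <= `|d t|.
  by apply: filterS Gfar => t /negP; rewrite -leNgt distrC.
have we : \forall t \near G, `|w t| = e.
  apply: filterS ed => t edt; have dt0 : 0 < `|d t| by apply: lt_le_trans edt.
  by rewrite normrZ normrM normfV normr_id gtr0_norm// mulfVK// gt_eqF.
have [w0 ww0] : exists w0 : 'rV[R]_n, w @ G --> w0.
  by apply: (ultra_bounded_cvg (M := e) GU); apply: filterS we => t /= ->.
have nw0 : e <= `|w0|.
  apply: (@cvgr_to_ge _ G _ R (fun t => `|w t|)); first exact: cvg_norm.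
  by apply: filterS we => t ->.
suff [_] : point_op D f x (f x + w0).
  by rewrite -[RHS]addr0 => /addrI w00; move: nw0; rewrite w00 normr0 leNgt e0.
apply: maximal_monotone_mem => // z _ [Dz ->].
have yxG : y @ G --> x by apply: cvg_trans yx => A; apply: FG.
pose h t := dot (w t) (y t - z) + dot (f x - f z) (x - z)
  + `|dot (f x - f z) (y t - x)|.
(* The term with [x - x] vanishes; it is the limit of the last term of [h]. *)
have -> : dot (f x + w0 - f z) (x - z) = dot w0 (x - z)
    + dot (f x - f z) (x - z) + `|dot (f x - f z) (x - x)|.
  by rewrite subrr -(scale0r x) dotZr mul0r normr0 addr0 -dotDl
    addrAC addrC.
apply: (@cvgr_to_ge _ G _ R h).
  have yz : (fun t => dot (w t) (y t - z)) @ G --> dot w0 (x - z).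
    exact: cvg_dot ww0 (cvg_sub_cst yxG).
  have cst_dot : (fun t => dot (f x - f z) (y t - x)) @ G -->
      dot (f x - f z) (x - x).
    exact: cvg_dot (cvg_cst _) (cvg_sub_cst yxG).
  exact: (cvgD (cvgD yz (cvg_cst _)) (cvg_norm cst_dot)).
have DyG : \forall t \near G, D (y t) by apply: FG.
apply: filterS2 ed DyG => t edt Dyt.
have dt0 : 0 < `|d t| by apply: lt_le_trans edt.
have s0 : 0 < s t by rewrite divr_gt0.
have s1 : s t <= 1 by rewrite ler_pdivrMr// mul1r.
have m1 : 0 <= dot (d t + (f x - f z)) (y t - z).
  by rewrite /d addrA subrK; apply: fmm.1; split.
have m2 : 0 <= dot (f x - f z) (x - z) by apply: fmm.1; split.
rewrite /h /w dotZl; set c := dot _ (y t - x).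
have cE : dot (f x - f z) (y t - z) = dot (f x - f z) (x - z) + c.
  by rewrite -dotDr [x - z + _]addrC addrA subrK.
move: m1; rewrite dotDl cE => m1.
(* [s t * m1 + (1 - s t) * m2] is [h t] with [s t * c] in place of [|c|]. *)
have := mulr_ge0 (ltW s0) m1.
have := mulr_ge0 (_ : 0 <= 1 - s t) m2; rewrite subr_ge0 => /(_ s1).
have : s t * c <= `|c|.
  by rewrite (le_trans (ler_norm _))// normrM gtr0_norm// ler_piMl.
by nra.
Qed.

(** * Bounded selections *)

Definition boundedly_selectable (R : realType) n (T : operator R n) : Prop :=
  forall V : set 'rV[R]_n, bounded_set V -> V `<=` dom T ->
  exists r : R, forall x, V x -> exists2 w, T x w & `|w| <= r.

(** Near an adherent point [x] of the domain, select values of [T] in a fixed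
ball; their limit along an ultrafilter converging to [x] is a value of [T] at
[x], because the graph is closed. *)
Lemma dom_closed (R : realType) n (T : operator R n) :
  maximal_monotone T -> boundedly_selectable T -> closed (dom T).
Proof.
move=> Tmm Tsel x xT.
have /ultra_not_near [G [GU xG GT]] : ~ nbhs x (~` dom T).
  by move=> /xT [y [? ]].
have {GT} GT : G (dom T) by apply: filterS GT => y /contrapT.
have GP : ProperFilter G by exact: ultra_proper.
pose V := dom T `&` [set y | `|y| <= `|x| + 1].
have Vb : bounded_set V by apply/bounded_setP; exists (`|x| + 1) => y [].
have [r rV] := Tsel V Vb (@subIsetl _ _ _).
have GV : G V.
  apply: filterI => //; apply: xG; apply/nbhs_ballP; exists 1 => //= y.
  rewrite -ball_normE/= => xy.
  rewrite -[y](subrK x) addrC (le_trans (ler_normD _ _))// lerD2l distrC.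
  exact: ltW.
have /choice[w wP] : forall y : 'rV[R]_n, exists v : 'rV[R]_n,
    V y -> T y v /\ `|v| <= r.
  move=> y; have [/rV[v Tv vr]|] := pselect (V y); first by exists v.
  by exists 0.
have [v wv] : exists v : 'rV[R]_n, w @ G --> v.
  by apply: (ultra_bounded_cvg (M := r) GU); apply: filterS GV => y /wP[].
exists v.
apply: (maximal_monotone_closed_graph (F := G) (y := id) (w := w)) => //.
by apply: filterS GV => y /wP[].
Qed.

(** Points of [V] with values growing without bound would have a limit point in
[C], hence in [D], where [f] is continuous. *)
Lemma point_op_bounded_on (R : realType) n (D C : set 'rV[R]_n)
    (f : 'rV[R]_n -> 'rV[R]_n) (V : set 'rV[R]_n) :
  maximal_monotone (point_op D f) -> closed C -> C `<=` D ->
  bounded_set V -> V `<=` C -> exists M : R, forall x, V x -> `|f x| <= M.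
Proof.
move=> fmm Cc CD /bounded_setP[N VN] VC; apply: contrapT => nM.
have /choice[y yV] : forall k : nat, exists x, V x /\ k%:R < `|f x|.
  move=> k; apply: contrapT => nx; apply: nM; exists k%:R => x Vx.
  by rewrite leNgt; apply/negP => kx; apply: nx; exists x.
have [G [GU ooG]] := ultraFilterLemma (eventually_filter).
have GP : ProperFilter G by exact: ultra_proper.
have [x0 yx] : exists x0 : 'rV[R]_n, y @ G --> x0.
  apply: (ultra_bounded_cvg (M := N) GU); apply: nearW => k /=.
  by apply/VN/(yV k).1.
have Cx0 : C x0.
  apply: (@closed_cvg _ _ G _ y C Cc _ _ yx).
  by apply: nearW => k; apply/VC/(yV k).1.
have fy : (fun k => f (y k)) @ G --> f x0.
  apply: (maximal_monotone_point_cvg fmm (CD _ Cx0) yx).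
  by apply: nearW => k; apply/CD/VC/(yV k).1.
have fyb : \forall k \near G, `|f (y k)| < `|f x0| + 1.
  by apply: (cvgr_norm_lt _ fy); rewrite ltrDl.
have big : \forall k \near G, `|f x0| + 1 <= k%:R.
  by apply: ooG; exact: nbhs_infty_ger.
have [k [/= k1 k2]] := filter_ex (filterI fyb big).
by have := lt_le_trans (lt_trans (yV k).2 k1) k2; rewrite ltxx.
Qed.

(** * One forward-backward step *)

Lemma forward_backwardP (R : realType) n (D : set 'rV[R]_n)
    (f : 'rV[R]_n -> 'rV[R]_n) (T : operator R n) (b : R) (x J : 'rV[R]_n) :
  0 < b -> forward_backward (point_op D f) T b x J ->
  D x /\ T J (b^-1 *: (x - J) - f x).
Proof.
move=> b0 [z [_ -> [_ [_ [Dx ->] <-]]] <-] [_ -> [_ [v Tv <-]]] /eqP.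
rewrite scaleNr => /eqP Jv; split=> //.
rewrite (_ : x - J = b *: (v + f x)).
  by rewrite scalerA mulVf ?gt_eqF// scale1r addrK.
by apply/rowP => i; move/rowP/(_ i): Jv; rewrite !mxE; lra.
Qed.

Section forward_backward_step.
Context (R : realType) (n : nat) (f : 'rV[R]_n -> 'rV[R]_n) (T : operator R n).
Context (b : R) (x J : 'rV[R]_n).
Context (b0 : 0 < b) (Tmon : Defs.monotone T).
Context (TJ : T J (b^-1 *: (x - J) - f x)).

(** Monotonicity between [p] and [J], when [p] lies on the open ray from [J]
through [x]: the point [x] itself and all trial points other than [J] are of
this kind. *)
Lemma dot_residual_le (p w : 'rV[R]_n) (c : R) : 0 < c ->
  T p w -> p - J = c *: (x - J) ->
  b^-1 * dot (x - J) (x - J) <= dot (f x + w) (x - J).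
Proof using Tmon TJ.
move=> c0 Tw pJ; have := Tmon Tw TJ; rewrite pJ dotZr pmulr_rge0//.
rewrite !dot_lin; lra.
Qed.

Lemma residual_le (w : 'rV[R]_n) : T x w ->
  `|x - J| <= b * (n%:R * `|f x + w|).
Proof using b0 Tmon TJ.
move=> Tw; have := dot_residual_le ltr01 Tw (esym (scale1r _)).
have := norm_sq_le_dot (x - J).
have := le_trans (ler_norm _) (dot_le_norm (f x + w) (x - J)).
have [->|nz] := eqVneq (x - J) 0.
  by move=> _ _ _; rewrite normr0 !mulr_ge0// ltW.
have N0 : 0 < `|x - J| by rewrite normr_gt0.
move=> h1 h2 h3.
have h4 : b^-1 * `|x - J| ^+ 2 <= n%:R * (`|f x + w| * `|x - J|).
  apply: le_trans h1; apply: le_trans h3; rewrite ler_wpM2l ?invr_ge0// ltW//.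
by move: h4; rewrite ler_pdivrMl// expr2 !mulrA ler_pM2r// mulrAC -!mulrA.
Qed.

(** Trial point number [j = 0] is [J] itself, about which monotonicity says
nothing; this is why [0 < j] is required.  Otherwise [dot_residual_le] gives
[|x - J|^2 / b] as a lower bound where the failed test gives [delta] times that
quantity as an upper bound, with [f p] in place of [f x]. *)
Lemma rejected_residual_le (theta delta : R) (j : nat) (u : 'rV[R]_n) :
  0 < theta < 1 -> delta < 1 -> (0 < j)%N ->
  let p := trial theta x J j in
  T p u -> ~ linesearch_test f delta b x J p u ->
  (1 - delta) * `|x - J| <= b * (n%:R * `|f x - f p|).
Proof using b0 Tmon TJ.
move=> /andP[t0 t1] d1 j0 p Tu; rewrite /linesearch_test enorm_sq => /negP.
rewrite -ltNge => rej.
have c0 : 0 < 1 - theta ^+ j by rewrite subr_gt0 exprn_ilt1 ?(ltW t0)// -lt0n.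
have pJ : p - J = (1 - theta ^+ j) *: (x - J).
  by rewrite /p /trial; apply/rowP => i; rewrite !mxE; ring.
have := dot_residual_le c0 Tu pJ.
have := norm_sq_le_dot (x - J).
have := le_trans (ler_norm _) (dot_le_norm (f x - f p) (x - J)).
have [->|nz] := eqVneq (x - J) 0.
  by move=> _ _ _; rewrite normr0 mulr0 !mulr_ge0// ltW.
have N0 : 0 < `|x - J| by rewrite normr_gt0.
move=> h1 h2 h3.
have h4 : (1 - delta) / b * `|x - J| ^+ 2 <= n%:R * (`|f x - f p| * `|x - J|).
  apply: le_trans h1.
  apply: (@le_trans _ _ ((1 - delta) / b * dot (x - J) (x - J))).
    by apply: ler_wpM2l => //; apply: divr_ge0; rewrite ?subr_ge0 ltW.
  move: rej h3; set s := dot (x - J) (x - J).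
  by rewrite !(dotDl (f _)) dotNl; lra.
move: h4; rewrite expr2 !mulrA ler_pM2r// mulrAC ler_pdivrMr//.
by rewrite [b * _]mulrC mulrAC.
Qed.

(** The accepted point [p] sits at [x - p = theta ^ j (x - J)], so the test
bounds from below how far [x] is beyond the cut at [p], hence the distance from
[x] to any point [y] of the cut. *)
Lemma accepted_residual_le (theta delta : R) (j : nat) (u y : 'rV[R]_n) :
  0 < theta -> 0 < delta ->
  let p := trial theta x J j in
  linesearch_test f delta b x J p u -> halfspace f p u y ->
  theta ^+ j * `|x - J| ^+ 2 <= b / delta * (n%:R * (`|f p + u| * `|y - x|)).
Proof using b0.
move=> t0 d0 p; rewrite /linesearch_test enorm_sq /halfspace/= => acc yH.
have tj0 : 0 < theta ^+ j by rewrite exprn_gt0.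
have xp : x - p = theta ^+ j *: (x - J).
  by rewrite /p /trial; apply/rowP => i; rewrite !mxE; ring.
have h1 : dot (f p + u) (x - p) <= n%:R * (`|f p + u| * `|y - x|).
  rewrite -[`|y - x|]normrN opprB.
  apply: le_trans (le_trans (ler_norm _) (dot_le_norm _ _)).
  by move: yH; rewrite !dotDr !dotNr; lra.
have h2 : theta ^+ j * (delta / b * `|x - J| ^+ 2) <=
    n%:R * (`|f p + u| * `|y - x|).
  apply: le_trans h1; rewrite xp dotZr ler_pM2l//; apply: le_trans acc.
  by rewrite ler_wpM2l ?norm_sq_le_dot// divr_ge0 ?ltW.
have -> : theta ^+ j * `|x - J| ^+ 2 =
    b / delta * (theta ^+ j * (delta / b * `|x - J| ^+ 2)).
  by field; rewrite !gt_eqF.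
by rewrite ler_wpM2l// divr_ge0 ?ltW.
Qed.

End forward_backward_step.

(** * Projections and Fejer monotonicity *)

(** Only the segment from [p] to [y] has to lie in [C], which is all that
convexity is used for. *)
Lemma proj_variational (R : realType) n (C : set 'rV[R]_n) (x p y : 'rV[R]_n) :
  is_proj C x p -> (forall t : R, 0 <= t <= 1 -> C (p + t *: (y - p))) ->
  dot (x - p) (y - p) <= 0.
Proof.
move=> [_ pmin] Cseg; rewrite leNgt; apply/negP; set c := dot _ _ => c0.
set E := dot (y - p) (y - p).
have E0 : 0 <= E by exact: dot_ge0.
have cE : 0 < E + c by rewrite ltr_wpDl.
(* Moving from [p] by [t] changes the squared distance to [x] by
   [t * (t * E - 2 * c)], negative for this [t] since [t * E < c]. *)
pose t := c / (E + c).
have t0 : 0 < t by rewrite divr_gt0.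
have t1 : t <= 1 by rewrite ler_pdivrMr// mul1r lerDr.
have := pmin _ (Cseg t _); rewrite (ltW t0) t1 => /(_ isT).
rewrite -(@ler_pXn2r _ 2)// ?nnegrE ?sqrtr_ge0// !enorm_sq.
have -> : x - (p + t *: (y - p)) = (x - p) - t *: (y - p).
  by rewrite opprD addrA.
rewrite (dotDl (x - p)) !(dotDr _ (- (t *: _))) !(dotNl, dotNr, dotZl, dotZr).
rewrite (dotC (y - p) (x - p)) -/c -/E.
have tE : t * (E + c) = c by rewrite mulfVK ?gt_eqF.
by nra.
Qed.

Lemma fejer_step (R : realType) n (C : set 'rV[R]_n) (x p y : 'rV[R]_n) :
  is_proj C x p -> (forall t : R, 0 <= t <= 1 -> C (p + t *: (y - p))) ->
  dot (p - y) (p - y) + dot (p - x) (p - x) <= dot (x - y) (x - y).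
Proof.
move=> pr Cseg; have := proj_variational pr Cseg.
have -> : x - y = (x - p) - (y - p) by rewrite opprB addrA subrK.
rewrite -(opprB y p) -(opprB x p) !(dotNl, dotNr) !opprK.
rewrite !(dotDl (x - p)) !(dotDr _ (- (y - p))).
rewrite !(dotNl (y - p), dotNr _ (y - p)).
rewrite (dotC (y - p) (x - p)); lra.
Qed.

Lemma halfspace_segment (R : realType) n (f : 'rV[R]_n -> 'rV[R]_n)
    (p u y z : 'rV[R]_n) (t : R) : 0 <= t <= 1 ->
  halfspace f p u y -> halfspace f p u z -> halfspace f p u (y + t *: (z - y)).
Proof.
rewrite /halfspace/= => /andP[t0 t1] hy hz.
have -> : y + t *: (z - y) - p = (1 - t) *: (y - p) + t *: (z - p).
  by apply/rowP => i; rewrite !mxE; ring.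
by rewrite dotDr !dotZr; nra.
Qed.

Lemma convex_set_segment (R : realType) n (X : set 'rV[R]_n)
    (y z : 'rV[R]_n) (t : R) :
  convex_set (X : set (convex_lmodType 'rV[R]_n)) -> 0 <= t <= 1 ->
  X y -> X z -> X (y + t *: (z - y)).
Proof.
move=> Xc /andP[t0 t1] Xy Xz.
have -> : y + t *: (z - y) = t *: z + (1 - t) *: y.
  by apply/rowP => i; rewrite !mxE; ring.
exact: set_mem (Xc z y (Itv01 t0 t1) (mem_set Xz) (mem_set Xy)).
Qed.

(** The distances to [l] decrease, so they tend to [0] as soon as they come
arbitrarily close to [0]. *)
Lemma fejer_cvg (R : realType) n (G : set_system nat) {FG : ProperFilter G}
    (x : nat -> 'rV[R]_n) (l : 'rV[R]_n) :
  (forall k, dot (x k.+1 - l) (x k.+1 - l) <= dot (x k - l) (x k - l)) ->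
  x @ G --> l -> x @ \oo --> l.
Proof.
move=> xdec xl; apply/cvgrPdist_lt => e e0.
have dl : (fun k => dot (x k - l) (x k - l)) @ G --> dot (l - l) (l - l).
  exact: cvg_dot (cvg_sub_cst xl) (cvg_sub_cst xl).
have [K /= Ke] : exists K, dot (x K - l) (x K - l) < e ^+ 2.
  apply/(@filter_ex _ G)/(cvgr_lt _ dl).
  by rewrite subrr -(scale0r l) dotZl mul0r exprn_gt0.
exists K => // k /= Kk; rewrite distrC.
rewrite -(@ltr_pXn2r _ 2)// ?nnegrE ?(ltW e0)//.
apply: le_lt_trans (norm_sq_le_dot _) (le_lt_trans _ Ke).
by have /nonincreasing_seqP := xdec; apply.
Qed.

Lemma sqr_decrease_cvg0 (R : realType) (a s : nat -> R) :
  (forall k, 0 <= a k) -> (forall k, 0 <= s k) ->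
  (forall k, a k.+1 + s k ^+ 2 <= a k) -> s @ \oo --> (0 : R).
Proof.
move=> a0 s0 as_.
have acvg : cvgn a.
  apply: nonincreasing_is_cvgn.
    apply/nonincreasing_seqP => k; apply: le_trans (as_ k).
    by rewrite lerDl sqr_ge0.
  by exists 0 => _ [k _ <-].
have diff : (fun k => a k - a k.+1) @ \oo --> (0 : R).
  rewrite -[0](subrr (limn a)); apply: cvgB => //.
  by rewrite (_ : (fun k => a k.+1) = [sequence a k.+1]_k)// cvg_shiftS.
apply/cvgr0Pnorm_lt => e e0.
have e2 : 0 < e ^+ 2 by rewrite exprn_gt0.
move/cvgr0Pnorm_lt : diff => /(_ _ e2); apply: filterS => k ke.
rewrite ger0_norm// -(@ltr_pXn2r _ 2)// ?nnegrE ?(ltW e0)//.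
apply: le_lt_trans ke; apply: le_trans (ler_norm _).
by have := as_ k; lra.
Qed.

(** * Cluster points are solutions *)

(** Given a target [e], continuity of [f] at [l] provides a radius [r], and [c]
is a threshold for [theta ^ js k] below which the trial point preceding the
accepted one is within [r / 2] of [x k]; the bound [c <= theta] makes sure that
it is neither [J k] nor missing, i.e. [1 < js k].  Above the threshold, the
squared residual is at most [C * s k / c]. *)
Lemma residual_vanishes (R : realType) n (D : set 'rV[R]_n)
    (f : 'rV[R]_n -> 'rV[R]_n) (x J : nat -> 'rV[R]_n) (js : nat -> nat)
    (theta C K M : R) (s : nat -> R) (G : set_system nat) {FG : Filter G}
    (l : 'rV[R]_n) :
  0 < theta < 1 -> 0 < C -> 0 < K -> 0 < M ->
  f @ within D (nbhs l) --> f l ->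
  (forall k, x k <> J k -> theta ^+ js k * `|x k - J k| ^+ 2 <= C * s k) ->
  (forall k, x k <> J k -> (1 < js k)%N ->
    let p := trial theta (x k) (J k) (js k).-1 in
    D p /\ `|x k - J k| <= K * `|f (x k) - f p|) ->
  (forall k, `|x k - J k| <= M) -> (forall k, D (x k)) ->
  s @ G --> (0 : R) -> x @ G --> l ->
  (fun k => x k - J k) @ G --> (0 : 'rV[R]_n).
Proof.
move=> /andP[t0 t1] C0 K0 M0 fl acc rej JM Dx s0 xl.
apply/cvgr0Pnorm_lt => e e0.
have eK : 0 < e / (2 * K) by rewrite divr_gt0// mulr_gt0.
have /nbhs_ballP[r /= r0 fr] :
    nbhs l [set y | D y -> `|f l - f y| < e / (2 * K)].
  by move/cvgrPdist_lt : fl => /(_ _ eK).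
have {}fr y : `|l - y| < r -> D y -> `|f l - f y| < e / (2 * K).
  by move=> ly; apply: fr; rewrite -ball_normE.
pose c := Num.min theta (theta * r / (2 * M)).
have c0 : 0 < c by rewrite lt_min t0/= divr_gt0 ?mulr_gt0.
have r2 : 0 < r / 2 by rewrite divr_gt0.
have se : 0 < e ^+ 2 * c / C by rewrite divr_gt0// mulr_gt0// exprn_gt0.
near=> k.
have xk : `|l - x k| < r / 2 by near: k; exact: cvgr_dist_lt xl _ r2.
have sk : `|s k| < e ^+ 2 * c / C by near: k; exact: cvgr0_norm_lt s0 _ se.
have [->|/eqP xJ] := eqVneq (x k) (J k); first by rewrite subrr normr0.
have [tc|ct] := ltP (theta ^+ js k) c.
- have jt : theta ^+ js k < theta by rewrite (lt_le_trans tc)// ge_min lexx.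
  have jr : theta ^+ js k < theta * r / (2 * M).
    by rewrite (lt_le_trans tc)// ge_min lexx orbT.
  have js2 : (1 < js k)%N.
    rewrite ltnNge; apply/negP => js1; move: jt; rewrite ltNge => /negP; apply.
    by rewrite -[leLHS]expr1 ler_wiXn2l// ltW.
  have [Dp] := rej k xJ js2; set p := trial _ _ _ _ in Dp *; move=> Jp.
  have xp : `|x k - p| <= r / 2.
    have -> : x k - p = theta ^+ (js k).-1 *: (x k - J k).
      by rewrite /p /trial; apply/rowP => i; rewrite !mxE; ring.
    rewrite normrZ gtr0_norm ?exprn_gt0//.
    apply: (@le_trans _ _ (r / (2 * M) * M)).
      apply: ler_pM => //; first by rewrite exprn_ge0// ltW.
      rewrite -(ler_pM2l t0) -exprS prednK ?(ltn_trans _ js2)// mulrA.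
      exact: ltW.
    by rewrite le_eqVlt; apply/orP; left; apply/eqP; field; rewrite gt_eqF.
  have lp : `|l - p| < r.
    rewrite -(subrK (x k) l) -addrA (le_lt_trans (ler_normD _ _))//.
    by rewrite [ltRHS]splitr ltr_leD.
  have fx := fr (x k) (lt_trans xk _) (Dx k); have fp := fr p lp Dp.
  apply: le_lt_trans Jp _; rewrite -ltr_pdivlMl// [K^-1 * e]mulrC.
  rewrite -(subrK (f l) (f (x k))) -addrA (le_lt_trans (ler_normD _ _))//.
  have -> : e / K = e / (2 * K) + e / (2 * K) by field; rewrite gt_eqF.
  rewrite ltrD//  distrC; apply: fx.
  by rewrite ltr_pdivrMr// mulr_natr mulr2n ltrDl.
- rewrite -(@ltr_pXn2r _ 2)// ?nnegrE ?(ltW e0)// -(ltr_pM2l c0).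
  have h := acc k xJ.
  apply: le_lt_trans (ler_wpM2r _ ct) (le_lt_trans h _); first exact: sqr_ge0.
  rewrite -ltr_pdivlMl// [C^-1 * _]mulrC [c * _]mulrC.
  exact: le_lt_trans (ler_norm _) sk.
Unshelve. all: by end_near. Qed.

Lemma zero_of_vanishing_residual (R : realType) n (T : operator R n)
    (f : 'rV[R]_n -> 'rV[R]_n) (x J : nat -> 'rV[R]_n) (b : nat -> R) (bmin : R)
    (G : set_system nat) {FG : ProperFilter G} (l : 'rV[R]_n) :
  maximal_monotone T -> 0 < bmin -> (forall k, bmin <= b k) ->
  (forall k, T (J k) ((b k)^-1 *: (x k - J k) - f (x k))) ->
  x @ G --> l -> (fun k => f (x k)) @ G --> f l ->
  (fun k => x k - J k) @ G --> (0 : 'rV[R]_n) -> T l (- f l).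
Proof.
move=> Tmm b0 bb TJ xl fl xJ.
have Jl : J @ G --> l.
  rewrite -[l]subr0 (_ : J = fun k => x k - (x k - J k)); first exact: cvgB.
  by apply/funext => k; rewrite opprB addrC subrK.
have bJ : (fun k => (b k)^-1 *: (x k - J k)) @ G --> (0 : 'rV[R]_n).
  apply/cvgr0Pnorm_lt => e e0.
  have be : 0 < bmin * e by rewrite mulr_gt0.
  move/cvgr0Pnorm_lt : xJ => /(_ _ be); apply: filterS => k ke.
  have bk : 0 < b k by apply: lt_le_trans (bb k).
  rewrite normrZ gtr0_norm ?invr_gt0// mulrC ltr_pdivrMr//.
  by apply: lt_le_trans ke _; rewrite mulrC ler_pM2l.
apply: (maximal_monotone_closed_graph (F := G) (y := J)
  (w := fun k => (b k)^-1 *: (x k - J k) - f (x k))) => //.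
  by rewrite -[- f l]add0r; exact: cvgB.
by apply: nearW => k; exact: TJ.
Qed.

(** * The convergence theorem *)

Lemma solution_in_halfspace (R : realType) n (D : set 'rV[R]_n)
    (f : 'rV[R]_n -> 'rV[R]_n) (T : operator R n) (p u y : 'rV[R]_n) :
  maximal_monotone (point_op D f) -> maximal_monotone T -> D p -> T p u ->
  sol_set (point_op D f) T y -> halfspace f p u y.
Proof.
move=> fmm Tmm Dp Tp [_ [Dy ->] [v Tv /eqP]]; rewrite addrC addr_eq0 => /eqP vE.
have := fmm.1 _ _ _ _ (conj Dp erefl) (conj Dy erefl).
have := Tmm.1 _ _ _ _ Tp Tv.
rewrite vE /halfspace/= -(opprB p y) dotNr !dotDl !dotNl; lra.
Qed.

Theorem theorem4p12 (R : realType) (n m : nat)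
  (DA : 'I_m -> set 'rV[R]_n) (A : 'I_m -> 'rV[R]_n -> 'rV[R]_n)
  (B : 'I_m -> operator R n) (X : set 'rV[R]_n)
  (beta : nat -> R) (bmin bmax theta delta Rad : R)
  (x : nat -> 'rV[R]_n) (J : nat -> 'I_m -> 'rV[R]_n)
  (u : nat -> 'I_m -> nat -> 'rV[R]_n) (js : nat -> 'I_m -> nat)
  (Sstar := \bigcap_(i in [set: 'I_m]) sol_set (point_op (DA i) (A i)) (B i))
  (hA : forall i, maximal_monotone (point_op (DA i) (A i)))
  (hB : forall i, maximal_monotone (B i))
  (hdom : forall i, dom (B i) `<=` dom (point_op (DA i) (A i)))
  (hX0 : X !=set0)
  (hXclosed : closed X)
  (hXconvex : convex_set (X : set (convex_lmodType 'rV[R]_n)))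
  (hXdom : X `<=` \bigcap_(i in [set: 'I_m]) dom (B i))
  (hXS : X `&` Sstar !=set0)
  (hBbnd : forall V : 'I_m -> set 'rV[R]_n, bounded_in_dom B V ->
     exists2 r : R, 0 < r & sel_bound B V r)
  (hbmin : 0 < bmin) (hbminmax : bmin <= bmax)
  (hbeta : forall k, bmin <= beta k <= bmax)
  (htheta : 0 < theta < 1) (hdelta : 0 < delta < 1)
  (hRad0 : 0 < Rad)
  (hRad : exists V : 'I_m -> set 'rV[R]_n,
     [/\ bounded_in_dom B V, sel_bound B V Rad &
         forall k i j, ~ solved (x k) (J k) i -> (j <= js k i)%N ->
           V i (trial theta (x k) (J k i) j)])
  (hrun : variantA2_run DA A B X beta theta delta Rad x J u js)
  (hnostop : never_stops x J) :
  exists2 xstar : 'rV[R]_n, (Sstar `&` X) xstar & x @ \oo --> xstar.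
Proof.
have [theta0 theta1] := andP htheta; have [delta0 delta1] := andP hdelta.
case: hrun => xinit res sel rej acc prj.
have b0 k : 0 < beta k by apply: lt_le_trans (andP (hbeta k)).1.
have DX i y : X y -> DA i y.
  by move=> /hXdom/(_ i I)/hdom[z []].
have domD i : dom (B i) `<=` DA i by move=> y /hdom[z []].
have Xx k : X (x k) by case: k => [//|k]; case: (prj k) => -[].
have Dx i k := DX i _ (Xx k).
have TJ k i : B i (J k i) ((beta k)^-1 *: (x k - J k i) - A i (x k)).
  by have [] := forward_backwardP (b0 k) (res k i).
pose s k := `|x k.+1 - x k|.
have s0 k : 0 <= s k by exact: normr_ge0.
have fejer y : X y -> Sstar y -> forall k,
    dot (x k.+1 - y) (x k.+1 - y) + s k ^+ 2 <= dot (x k - y) (x k - y).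
  move=> Xy Sy k; apply: (@le_trans _ _ (dot (x k.+1 - y) (x k.+1 - y)
    + dot (x k.+1 - x k) (x k.+1 - x k))).
    by rewrite lerD2l norm_sq_le_dot.
  apply: (fejer_step (prj k)) => t t01; have [[_ Hx] _] := prj k; split.
    by apply: convex_set_segment.
  move=> i nsi; apply: halfspace_segment => //; first exact: Hx.
  have [Bu _] := sel k i _ nsi (leqnn _).
  apply: (solution_in_halfspace (hA i) (hB i) _ Bu (Sy i I)).
  by apply: domD; exists (u k i (js k i)).
have [y [Xy Sy]] := hXS.
have s_cvg : s @ \oo --> (0 : R).
  apply: (@sqr_decrease_cvg0 _ (fun k => dot (x k - y) (x k - y))) => //.
  - by move=> k; exact: dot_ge0.
  - exact: (fejer y Xy Sy).
have xbnd k : `|x k| <= `|y| + Num.sqrt (dot (x 0%N - y) (x 0%N - y)).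
  rewrite -[x k](subrK y) addrC (le_trans (ler_normD _ _))// lerD2l.
  apply: le_trans (norm_le_enorm _) _; apply: ler_wsqrtr.
  have dec : nonincreasing_seq (fun k => dot (x k - y) (x k - y)).
    apply/nonincreasing_seqP => j; apply: le_trans (fejer y Xy Sy j).
    by rewrite lerDl sqr_ge0.
  exact: dec.
have bsel i : boundedly_selectable (B i).
  move=> V Vb VB.
  (* The family that is [V] at [i] and empty elsewhere. *)
  have [j|r _ rV] := hBbnd (fun j => [set z | j = i /\ V z]).
    split; last by move=> z [-> /VB].
    move/bounded_setP : Vb => [M MV].
    by apply/bounded_setP; exists M => z [_ /MV].
  exists r => z Vz; have [v [Bv]] := rV i z (conj erefl Vz).
  rewrite /cball/= subr0 => vr.
  by exists v => //; apply: le_trans vr; exact: norm_le_enorm.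
have domC i : closed (dom (B i)) by exact: dom_closed.
have xrange : bounded_set (range x).
  by apply/bounded_setP; eexists => _ [k _ <-]; exact: xbnd.
have xdom i : range x `<=` dom (B i).
  by move=> _ [k _ <-]; exact: hXdom (Xx k) i I.
have [G [GU ooG]] := ultraFilterLemma (eventually_filter).
have GP : ProperFilter G by exact: ultra_proper.
have [l xl] : exists l : 'rV[R]_n, x @ G --> l.
  by apply: (ultra_bounded_cvg GU); apply: nearW => k /=; exact: xbnd.
have Xl : X l by apply: (@closed_cvg _ _ G _ x X hXclosed _ _ xl); exact: nearW.
suff Sl : Sstar l.
  exists l => //; apply: (fejer_cvg (G := G)) => // k.
  by apply: le_trans (fejer l Xl Sl k); rewrite lerDl sqr_ge0.
move=> i _.
have [V [VB _ Vtrial]] := hRad.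
have [Mx Mxb] := point_op_bounded_on (hA i) (domC i) (domD i) xrange (xdom i).
have [Mp Mpb] := point_op_bounded_on (hA i) (domC i) (domD i) (VB i).1 (VB i).2.
have [r rb] := bsel i _ xrange (xdom i).
have Axl : (fun k => A i (x k)) @ G --> A i l.
  by apply: (maximal_monotone_point_cvg (hA i) (DX i _ Xl) xl); exact: nearW.
suff Rl : (fun k => x k - J k i) @ G --> (0 : 'rV[R]_n).
  exists (A i l); first by split => //; exact: DX.
  exists (- A i l); last by rewrite subrr.
  apply: (@zero_of_vanishing_residual R n (B i) (A i) x (fun k => J k i) beta bmin
    G GP l) => //.
  by move=> k; have /andP[] := hbeta k.
(* Adding [1] keeps these constants positive when [n = 0] or the bounds on the
   values of [A i] and [B i] are [0]. *)
pose C := bmax / delta * (n%:R * (`|Mp| + Rad)) + 1.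
pose K := bmax * n%:R / (1 - delta) + 1.
pose M := bmax * (n%:R * (`|Mx| + `|r|)) + 1.
have bmax0 : 0 < bmax by exact: lt_le_trans hbminmax.
have d0 : 0 < 1 - delta by rewrite subr_gt0.
have bb k : beta k <= bmax by have /andP[] := hbeta k.
apply: (@residual_vanishes _ _ (DA i) (A i) x (fun k => J k i)
  (fun k => js k i) theta C K M s G GP l) => //.
- by rewrite ltr_wpDl// mulr_ge0 ?divr_ge0 ?(ltW bmax0) ?(ltW delta0)//
    mulr_ge0// addr_ge0// ltW.
- by rewrite ltr_wpDl// divr_ge0 ?(ltW d0)// mulr_ge0// ltW.
- by rewrite ltr_wpDl// mulr_ge0 ?(ltW bmax0)// mulr_ge0// addr_ge0.
- apply: (maximal_monotone_point_cvg (y := id) (hA i) (DX i _ Xl)).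
    exact: cvg_within.
  exact: withinT.
- move=> k nsi; have [Bu ub] := sel k i _ nsi (leqnn _).
  have [[_ Hx] _] := prj k.
  apply: le_trans (accepted_residual_le (b0 k) theta0 delta0 (acc k i nsi)
    (Hx i nsi)) _.
  rewrite -/(s k); set p := trial _ _ _ _.
  have Ap : `|A i p + u k i (js k i)| <= `|Mp| + Rad.
    apply: le_trans (ler_normD _ _) _; apply: lerD.
      by apply: le_trans (Mpb _ (Vtrial k i _ nsi (leqnn _))) (ler_norm _).
    move: ub; rewrite /cball/= subr0; exact/le_trans/norm_le_enorm.
  apply: (@le_trans _ _ (bmax / delta * (n%:R * (`|Mp| + Rad)) * s k)).
    rewrite -[leRHS]mulrA -[X in _ <= _ * X]mulrA; apply: ler_pM.
    - by rewrite divr_ge0 ?(ltW (b0 k)) ?(ltW delta0).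
    - by rewrite !mulr_ge0.
    - by rewrite ler_wpM2r// invr_ge0 ltW.
    - by rewrite ler_wpM2l// ler_wpM2r.
  by rewrite ler_wpM2r// lerDl.
- move=> k nsi js2 p.
  have j1 : (0 < (js k i).-1)%N by rewrite -subn1 subn_gt0.
  have jlt : ((js k i).-1 < js k i)%N by rewrite prednK// (ltn_trans _ js2).
  have [Bu _] := sel k i _ nsi (ltnW jlt).
  split; first by apply: domD; exists (u k i (js k i).-1).
  have := rejected_residual_le (b0 k) (hB i).1 (TJ k i) htheta delta1 j1 Bu
    (rej k i _ nsi jlt).
  rewrite -/p -ler_pdivlMl// => h; apply: le_trans h _.
  rewrite !mulrA ler_wpM2r// /K [_^-1 * _]mulrC mulrAC.
  apply: (@le_trans _ _ (bmax * n%:R / (1 - delta))); last by rewrite lerDl.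
  by rewrite ler_wpM2r ?invr_ge0 ?(ltW d0)// ler_wpM2r.
- move=> k.
  have [w Bw wr] := rb (x k) (imageT x k).
  apply: le_trans (residual_le (b0 k) (hB i).1 (TJ k i) Bw) _.
  apply: (@le_trans _ _ (bmax * (n%:R * (`|Mx| + `|r|)))); last by rewrite lerDl.
  apply: ler_pM => //; first exact: ltW.
  rewrite ler_wpM2l//; apply: le_trans (ler_normD _ _) _; apply: lerD.
    by apply: le_trans (Mxb _ (imageT x k)) (ler_norm _).
  exact: le_trans wr (ler_norm _).
- exact: cvg_trans (cvg_app _ ooG) s_cvg.
Qed.
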